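(* Let $\|\cdot\|:\mathbb{R}^m\to\mathbb{R}$ be a norm, semi-norm or convex functional, and let $\mathbf{F},\widetilde{\mathbf{F}}:\mathbb{R}^m\to\mathbb{R}^m$ be such that for some $\Delta t_{\mathrm{FE}}>0$ and $\widetilde{\Delta t}_{\mathrm{FE}}>0$, $$\|\mathbf{u}+\Delta t\,\mathbf{F}(\mathbf{u})\|\le\|\mathbf{u}\|\quad \forall \mathbf{u}\in\mathbb{R}^m,\ 0\le\Delta t\le\Delta t_{\mathrm{FE}},$$ $$\|\mathbf{u}-\Delta t\,\widetilde{\mathbf{F}}(\mathbf{u})\|\le\|\mathbf{u}\|\quad \forall \mathbf{u}\in\mathbb{R}^m,\ 0\le\Delta t\le\widetilde{\Delta t}_{\mathrm{FE}}.$$ Let a consistent $k$-step perturbed linear multistep method be SSP with SSP coefficients $(\mathcal{C},\widetilde{\mathcal{C}})$. Then the numerical solution satisfies $$\|\mathbf{u}_n\|\le\max\{\|\mathbf{u}_{n-1}\|,\dots,\|\mathbf{u}_{n-k}\|\}$$ under the step-size restriction $$\Delta t\le\min\{\mathcal{C}\,\Delta t_{\mathrm{FE}},\ \widetilde{\mathcal{C}}\,\widetilde{\Delta t}_{\mathrm{FE}}\}.$$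
   Context: A $k$-step perturbed linear multistep method ($k\ge1$) with real coefficients $\alpha_0,\dots,\alpha_{k-1}$, $\beta_0,\dots,\beta_k$, $\tilde\beta_0,\dots,\tilde\beta_k$ computes, with step size $\Delta t\ge 0$, a numerical solution $\mathbf{u}_n\in\mathbb{R}^m$ satisfying $$\mathbf{u}_n=\sum_{j=0}^{k-1}\alpha_j\mathbf{u}_{n-k+j}+\Delta t\sum_{j=0}^{k}\left(\beta_j\mathbf{F}(\mathbf{u}_{n-k+j})-\tilde\beta_j\widetilde{\mathbf{F}}(\mathbf{u}_{n-k+j})\right).$$ The method is consistent if $\sum_{j=0}^{k-1}\alpha_j=1$ and $\sum_{j=0}^{k-1}j\alpha_j+\sum_{j=0}^k(\beta_j-\tilde\beta_j)=k$. The method is SSP with SSP coefficients $(\mathcal{C},\widetilde{\mathcal{C}})$ if $\beta_j,\tilde\beta_j\ge0$ for $j\in\{0,\dots,k\}$ and $\alpha_j-r\beta_j-\tilde r\tilde\beta_j\ge0$ for $j\in\{0,\dots,k-1\}$ hold for all $0\le r\le\mathcal{C}$ and $0\le\tilde r\le\widetilde{\mathcal{C}}$. *)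

(* Defs.v *)
From HB Require Import structures.
From mathcomp Require Import all_boot all_order all_algebra.
From mathcomp Require Import classical_sets reals convex.
Import Order.TTheory GRing.Theory Num.Theory.

Set Implicit Arguments.
Unset Strict Implicit.
Unset Printing Implicit Defensive.

Local Open Scope ring_scope.

Definition is_seminorm (R : realType) (m : nat) (phi : 'rV[R]_m -> R) : Prop :=
  (forall x y, phi (x + y) <= phi x + phi y) /\
  (forall (a : R) x, phi (a *: x) = `|a| * phi x).

Definition is_norm (R : realType) (m : nat) (phi : 'rV[R]_m -> R) : Prop :=
  is_seminorm phi /\ (forall x, phi x = 0 -> x = 0).

Definition is_convex_functional (R : realType) (m : nat)
    (phi : 'rV[R]_m -> R) : Prop :=
  convex_function [set: 'rV[R]_m]%classic phi.

Record perturbed_lmm (R : realType) (k : nat) := PerturbedLMM {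
  alpha : 'I_k -> R;
  beta : 'I_k.+1 -> R;
  tbeta : 'I_k.+1 -> R
}.

Definition consistent (R : realType) (k : nat) (M : perturbed_lmm R k) : Prop :=
  \sum_(j < k) alpha M j = 1 /\
  \sum_(j < k) j%:R * alpha M j + \sum_(j < k.+1) (beta M j - tbeta M j) = k%:R.

(* [widen_ord (leqnSn k) j] is the index j < k seen in 'I_k.+1. *)
Definition ssp (R : realType) (k : nat) (M : perturbed_lmm R k) (C tC : R) : Prop :=
  forall r tr : R, 0 <= r <= C -> 0 <= tr <= tC ->
    (forall j : 'I_k.+1, 0 <= beta M j /\ 0 <= tbeta M j) /\
    (forall j : 'I_k,
       0 <= alpha M j - r * beta M (widen_ord (leqnSn k) j)
                      - tr * tbeta M (widen_ord (leqnSn k) j)).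

(* The method may be implicit: the term j = k involves u n itself.  The
   subtraction n - k is the intended one only for k <= n. *)
Definition lmm_step (R : realType) (k m : nat) (M : perturbed_lmm R k)
    (F tF : 'rV[R]_m -> 'rV[R]_m) (dt : R) (u : nat -> 'rV[R]_m) (n : nat) : Prop :=
  u n = \sum_(j < k) alpha M j *: u (n - k + j)%N
        + dt *: \sum_(j < k.+1) (beta M j *: F (u (n - k + j)%N)
                                 - tbeta M j *: tF (u (n - k + j)%N)).

(* Main.v *)
(* With r = dt / dtFE and tr = dt / tdtFE, adding s u_n, s = r beta_k + tr tbeta_k,
   to both sides of the scheme gives
     (1 + s) u_n = \sum_(j < k) [(alpha_j - r beta_j - tr tbeta_j) u_j
                    + r beta_j (u_j + dtFE F u_j) + tr tbeta_j (u_j - tdtFE tF u_j)]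
                 + r beta_k (u_n + dtFE F u_n) + tr tbeta_k (u_n - tdtFE tF u_n),
   a nonnegative combination of total weight 1 + s.  Jensen's inequality and the
   forward Euler bounds yield
     (1 + s) phi u_n <= \sum_(j < k) alpha_j phi u_j + s phi u_n,
   where s phi u_n cancels even for implicit methods. *)
Require Import Defs.
From HB Require Import structures.
From mathcomp Require Import all_boot all_order all_algebra.
From mathcomp Require Import classical_sets reals convex.
From mathcomp Require Import interval_inference lra zify.
Import Order.TTheory GRing.Theory Num.Theory.

Local Open Scope ring_scope.

(** Common ground of the three kinds of functional: besides the forward Euler bounds, only this is
    used of [phi]. *)
Definition jensen2 {R : realType} {V : lmodType R} (phi : V -> R) : Prop :=
  forall (a b : R) (x y : V), 0 <= a -> 0 <= b -> a + b = 1 ->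
    phi (a *: x + b *: y) <= a * phi x + b * phi y.

Lemma seminorm_jensen2 (R : realType) (m : nat) (phi : 'rV[R]_m -> R) :
  is_seminorm phi -> jensen2 phi.
Proof.
move=> [phiD phiZ] a b x y a0 b0 _.
by apply: le_trans (phiD _ _) _; rewrite !phiZ !ger0_norm.
Qed.

Lemma convex_jensen2 (R : realType) (m : nat) (phi : 'rV[R]_m -> R) :
  is_convex_functional phi -> jensen2 phi.
Proof.
move=> cvx a b x y a0 b0 ab1.
have a01 : 0 <= a <= 1 by rewrite a0 -ab1 lerDl.
have bE : b = 1 - a by rewrite -ab1 addrAC subrr add0r.
have := cvx (Itv01 a0 (proj2 (andP a01))) x y.
rewrite !inE => /(_ I I).
by rewrite bE.
Qed.

(* The cone over the epigraph of phi: for w > 0 this reads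
   w * phi (w^-1 *: v) <= c, and unlike that formula it is additive at w = 0. *)
Definition epi_cone {R : realType} {V : lmodType R} (phi : V -> R)
    (w : R) (v : V) (c : R) : Prop :=
  0 <= w /\ exists x, v = w *: x /\ w * phi x <= c.

Section EpiCone.
Context {R : realType} {V : lmodType R} (phi : V -> R).
Hypothesis phi_jensen : jensen2 phi.

Lemma epi_cone0 : epi_cone phi 0 0 0.
Proof. by split=> //; exists 0; rewrite scaler0 mul0r. Qed.

Lemma epi_coneZ (w : R) (x y : V) :
  0 <= w -> phi x <= phi y -> epi_cone phi w (w *: x) (w * phi y).
Proof. by move=> w0 xy; split=> //; exists x; rewrite ler_wpM2l. Qed.

(** For positive total weight the witness is the weighted mean of [x1] and [x2]; Jensen's inequality
    is then scaled by [w1 + w2]. *)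
Lemma epi_coneD (w1 : R) (v1 : V) (c1 w2 : R) (v2 : V) (c2 : R) :
  epi_cone phi w1 v1 c1 -> epi_cone phi w2 v2 c2 ->
  epi_cone phi (w1 + w2) (v1 + v2) (c1 + c2).
Proof.
move=> [w10 [x1 [-> le1]]] [w20 [x2 [-> le2]]]; split; first exact: addr_ge0.
have [w0|w_neq0] := eqVneq (w1 + w2) 0.
  (* Both vectors vanish and both bounds are nonnegative, so any witness serves. *)
  have [w1E w2E] : w1 = 0 /\ w2 = 0 by split; lra.
  move: le1 le2; rewrite w1E w2E !mul0r => c10 c20.
  exists x1; rewrite addr0 !scale0r addr0 mul0r; split=> //.
  exact: addr_ge0.
have w_gt0 : 0 < w1 + w2 by rewrite lt_neqAle eq_sym w_neq0 addr_ge0.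
exists (w1 / (w1 + w2) *: x1 + w2 / (w1 + w2) *: x2); split.
  by rewrite scalerDr !scalerA !(mulrC (w1 + w2)) !divfK.
apply: le_trans (lerD le1 le2).
have := phi_jensen _ _ x1 x2 (divr_ge0 w10 (ltW w_gt0)) (divr_ge0 w20 (ltW w_gt0)).
rewrite -mulrDl divff// => /(_ erefl) /(ler_wpM2l (ltW w_gt0)) /le_trans; apply.
by rewrite mulrDr !mulrA !(mulrC (w1 + w2)) !mulfK.
Qed.

Lemma epi_cone_sum (I : Type) (s : seq I) (w : I -> R) (v : I -> V) (c : I -> R) :
  (forall i, epi_cone phi (w i) (v i) (c i)) ->
  epi_cone phi (\sum_(i <- s) w i) (\sum_(i <- s) v i) (\sum_(i <- s) c i).
Proof.
move=> wvc; apply: (@big_ind3 _ _ _ (epi_cone phi)) => //.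
  exact: epi_cone0.
by move=> *; exact: epi_coneD.
Qed.

Lemma epi_cone_le (w : R) (x : V) (c : R) :
  0 < w -> epi_cone phi w (w *: x) c -> w * phi x <= c.
Proof. by move=> w0 [_ [y [/(scalerI (lt0r_neq0 w0)) -> ]]]. Qed.

(** The vector splits into [x], [x - th *: tF x] and [x + h *: F x] with weights
    [a - r * b - tr * c], [tr * c] and [r * b], whose sum is [a]. *)
Lemma epi_cone_forward_euler (F tF : V -> V) (h th r tr dt a b c : R) (x : V) :
  phi (x + h *: F x) <= phi x -> phi (x - th *: tF x) <= phi x ->
  dt = r * h -> dt = tr * th -> 0 <= r -> 0 <= tr -> 0 <= b -> 0 <= c ->
  0 <= a - r * b - tr * c ->
  epi_cone phi a (a *: x + dt *: (b *: F x - c *: tF x)) (a * phi x).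
Proof.
move=> Fx tFx dt_r dt_tr r0 tr0 b0 c0 abc0.
have := epi_coneD _ _ _ _ _ _
  (epi_coneD _ _ _ _ _ _ (epi_coneZ _ _ _ abc0 (lexx (phi x)))
    (epi_coneZ _ _ _ (mulr_ge0 tr0 c0) tFx))
  (epi_coneZ _ _ _ (mulr_ge0 r0 b0) Fx).
rewrite -!mulrDl !subrK; congr epi_cone.
rewrite !scalerDr !scalerN !scalerA.
rewrite [r * b * h]mulrAC -dt_r [tr * c * th]mulrAC -dt_tr.
rewrite [X in X + _ = _]addrA -scalerDl subrK addrACA -scalerDl subrK.
by rewrite [- _ + _]addrC.
Qed.

End EpiCone.

(* The neutral element phi (u n.-1) of the maximum is its i = 1 term. *)
Theorem theorem2p1 (R : realType) (m k : nat) (k_ge1 : (1 <= k)%N)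
  (phi : 'rV[R]_m -> R)
  (phiP : is_norm phi \/ is_seminorm phi \/ is_convex_functional phi)
  (F tF : 'rV[R]_m -> 'rV[R]_m) (dtFE tdtFE : R)
  (dtFE_gt0 : 0 < dtFE) (tdtFE_gt0 : 0 < tdtFE)
  (F_FE : forall (u : 'rV[R]_m) (dt : R),
     0 <= dt <= dtFE -> phi (u + dt *: F u) <= phi u)
  (tF_FE : forall (u : 'rV[R]_m) (dt : R),
     0 <= dt <= tdtFE -> phi (u - dt *: tF u) <= phi u)
  (M : perturbed_lmm R k) (C tC : R)
  (M_consistent : consistent M) (M_ssp : ssp M C tC)
  (dt : R) (dt_ge0 : 0 <= dt)
  (dt_le : dt <= Num.min (C * dtFE) (tC * tdtFE))
  (u : nat -> 'rV[R]_m) (n : nat) (n_gek : (k <= n)%N)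
  (u_step : lmm_step M F tF dt u n) :
  phi (u n) <= \big[Num.max/phi (u n.-1)]_(1 <= i < k.+1) phi (u (n - i)%N).
Proof.
have phi_jensen : jensen2 phi.
  by case: phiP => [[/seminorm_jensen2]|[/seminorm_jensen2|/convex_jensen2]].
move: dt_le; rewrite le_min => /andP[dt_leF dt_letF].
pose r := dt / dtFE; pose tr := dt / tdtFE.
have dt_r : dt = r * dtFE by rewrite divfK// gt_eqF.
have dt_tr : dt = tr * tdtFE by rewrite divfK// gt_eqF.
have r0 : 0 <= r by rewrite divr_ge0// ltW.
have tr0 : 0 <= tr by rewrite divr_ge0// ltW.
have rC : 0 <= r <= C by rewrite r0 ler_pdivrMr.
have trC : 0 <= tr <= tC by rewrite tr0 ler_pdivrMr.
have [beta_ge0 coef_ge0] := M_ssp _ _ rC trC.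
have F_le x : phi (x + dtFE *: F x) <= phi x by rewrite F_FE// lexx ltW.
have tF_le x : phi (x - tdtFE *: tF x) <= phi x by rewrite tF_FE// lexx ltW.
have alpha_ge0 j : 0 <= alpha M j.
  have [b0 tb0] := beta_ge0 (widen_ord (leqnSn k) j).
  by have := coef_ge0 j; have := mulr_ge0 r0 b0; have := mulr_ge0 tr0 tb0; lra.
have term a (j : 'I_k.+1) x : 0 <= a - r * beta M j - tr * tbeta M j ->
    epi_cone phi a (a *: x + dt *: (beta M j *: F x - tbeta M j *: tF x))
      (a * phi x).
  have [b0 tb0] := beta_ge0 j.
  exact: (epi_cone_forward_euler phi phi_jensen _ _ _ _ _ _ _ _ _ _ _
            (F_le x) (tF_le x) dt_r dt_tr).
pose s := r * beta M ord_max + tr * tbeta M ord_max.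
have s0 : 0 <= s.
  by have [b0 tb0] := beta_ge0 ord_max; rewrite addr_ge0// mulr_ge0.
have [alpha1 _] := M_consistent.
have explicit_part := epi_cone_sum phi phi_jensen _ (index_enum 'I_k) _ _ _
  (fun j => term (alpha M j) _ (u (n - k + j)%N) (coef_ge0 j)).
(* At index k the weight [s] takes the place of a coefficient alpha; the weight left on [u n] alone
   is then exactly 0. *)
have implicit_part : epi_cone phi s
    (s *: u n + dt *: (beta M ord_max *: F (u n) - tbeta M ord_max *: tF (u n)))
    (s * phi (u n)).
  by apply: term; rewrite /s; lra.
have := epi_coneD phi phi_jensen _ _ _ _ _ _ explicit_part implicit_part.
have -> : \sum_(j < k) (alpha M j *: u (n - k + j)%N + dt *:
      (beta M (widen_ord (leqnSn k) j) *: F (u (n - k + j)%N)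
       - tbeta M (widen_ord (leqnSn k) j) *: tF (u (n - k + j)%N)))
    + (s *: u n + dt *: (beta M ord_max *: F (u n) - tbeta M ord_max *: tF (u n)))
    = (1 + s) *: u n.
  (* The scheme replaces only the copy of [u n] of weight 1; [s *: u n] stays. *)
  rewrite big_split -scaler_sumr scalerDl scale1r [X in _ = X + _]u_step.
  rewrite big_ord_recr /= subnK// [in RHS]scalerDr.
  by rewrite [in LHS]addrA [in RHS]addrA [RHS]addrAC.
rewrite alpha1 => /(epi_cone_le _ _ _ _ (ltr_wpDr s0 ltr01)).
rewrite mulrDl mul1r lerD2r => /le_trans; apply.
set L := \big[_/_]_(_ <= _ < _) _.
have u_le (j : 'I_k) : phi (u (n - k + j)%N) <= L.
  (* By [k <= n], step j is the term i = k - j of the maximum, and 1 <= i <= k. *)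
  have -> : (n - k + j = n - (k - j))%N by have := ltn_ord j; lia.
  apply: le_bigmax_seq => //; rewrite mem_index_iota; have := ltn_ord j; lia.
(* Consistency spreads [L] over the weights alpha, for a termwise comparison. *)
rewrite -[leRHS]mul1r -alpha1 mulr_suml.
by apply: ler_sum => j _; exact: ler_wpM2l.
Qed.
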